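(* Let $\Theta\subseteq\mathbb{R}^d$ be a set of parameters, let $\Theta'\subseteq\Theta$ be a subset which is not a singleton, and let $P_\theta$, $\theta\in\Theta'$, be a corresponding collection of probability distributions on some measurable space $\mathcal{X}$. Let $\mathbf{X}\sim P_\theta$ be a random variable taking values in $\mathcal{X}$. Suppose that there exist an extreme point $\theta_e\in\Theta'$ of $\Theta'$ and an additional point $\theta'\in\Theta'$, $\theta'\neq\theta_e$, such that $P_{\theta'}$ and $P_{\theta_e}$ are absolutely continuous with respect to one another. Then there exists no unbiased estimator $g(\mathbf{X})$ for $\theta$ which is measurable with respect to the Lebesgue $\sigma$-algebra and whose range is $\Theta'$.
   Context: An estimator whose range is $\Theta'$ is a measurable function $g:\mathcal{X}\to\Theta'\subseteq\mathbb{R}^d$, i.e. all its values lie in $\Theta'$ (measurability is with respect to the Lebesgue $\sigma$-algebra on $\mathbb{R}^d$). It is unbiased if for every $\theta\in\Theta'$ the expectation exists and $\mathbb{E}_{P_\theta}(g(\mathbf{X}))=\int_{\mathcal{X}} g\,dP_\theta=\theta$. The set $\Theta'$ need not be convex; an extreme point of a set $S\subseteq\mathbb{R}^d$ is a point of $S$ that is not a convex combination of other points of $S$, i.e. a point $s\in S$ with $s\notin \mathrm{Conv}(S\setminus\{s\})$, where $\mathrm{Conv}$ denotes the convex hull. Two distributions are absolutely continuous with respect to one another if they have the same null sets. *)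

(* Defs.v *)
From HB Require Import structures.
From mathcomp Require Import all_boot all_order all_algebra.
From mathcomp Require Import all_classical all_reals all_analysis.
Import Order.TTheory GRing.Theory Num.Theory.
Import numFieldNormedType.Exports.

Set Implicit Arguments.
Unset Strict Implicit.
Unset Printing Implicit Defensive.

Local Open Scope classical_set_scope.
Local Open Scope ring_scope.

Section lebesgue_outer.
Local Open Scope ereal_scope.
Variables (R : realType) (d : nat).

(* [box (Some (a, b))] is the half-open box \prod_i ]a_i, b_i], which is empty
   as soon as b_i <= a_i for some i.  [None] is the empty set, so that covers
   by sequences of boxes include the finite and the empty covers (a box is
   never empty when d = 0). *)
Definition box (I : option ('rV[R]_d * 'rV[R]_d)) : set 'rV[R]_d :=
  if I is Some (a, b) then
    [set x | forall i, (a ord0 i < x ord0 i <= b ord0 i)%R]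
  else set0.

Definition box_volume (I : option ('rV[R]_d * 'rV[R]_d)) : R :=
  if I is Some (a, b) then (\prod_i Num.max 0 (b ord0 i - a ord0 i))%R else 0%R.

Lemma box_volume_ge0 I : 0 <= (box_volume I)%:E.
Proof.
rewrite lee_fin; case: I => [[a b]|]//=.
by apply: prodr_ge0 => i _; rewrite le_max lexx.
Qed.

Definition lebesgue_outer (A : set 'rV[R]_d) : \bar R :=
  ereal_inf [set \sum_(k <oo) (box_volume (I k))%:E |
             I in [set I : nat -> option ('rV[R]_d * 'rV[R]_d) |
                   A `<=` \bigcup_k box (I k)]].

Let lebesgue_outer_ge0 A : 0 <= lebesgue_outer A.
Proof.
apply: le_ereal_inf_tmp => _ [I _ <-]; apply: nneseries_ge0 => k _ _.
exact: box_volume_ge0.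
Qed.

Let lebesgue_outer0 : lebesgue_outer set0 = 0.
Proof.
apply/eqP; rewrite eq_le lebesgue_outer_ge0 andbT.
by apply: ereal_inf_lbound; exists (fun=> None) => //; exact: eseries0.
Qed.

Let le_lebesgue_outer :
  {homo lebesgue_outer : A B / A `<=` B >-> A <= B}.
Proof.
move=> A B AB; apply/ereal_inf_le_tmp => _ [I BI <-]; exists I => //.
exact: subset_trans AB BI.
Qed.

Let lebesgue_outer_sigma_subadditive : sigma_subadditive lebesgue_outer.
Proof.
move=> A; have [[i ioo]|] := pselect (exists i, lebesgue_outer (A i) = +oo).
  rewrite (eseries_pinfty _ _ ioo) ?leey// => n _.
  by rewrite -ltNye (lt_le_trans _ (lebesgue_outer_ge0 _)).
rewrite -forallNE => Aoo.
suff add2e (e : {posnum R}) : lebesgue_outer (\bigcup_n A n) <=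
    \sum_(i <oo) lebesgue_outer (A i) + e%:num%:E.
  by apply/lee_addgt0Pr => _/posnumP[].
rewrite (le_trans _ (epsilon_trick _ _ _))//.
pose P n (I : nat -> option ('rV[R]_d * 'rV[R]_d)) :=
  A n `<=` \bigcup_k box (I k) /\
  \sum_(k <oo) (box_volume (I k))%:E <=
    lebesgue_outer (A n) + (e%:num / (2 ^ n.+1)%:R)%:E.
have [G PG] : {G & forall n, P n (G n)}.
  apply: (@choice _ _ P) => n; rewrite /P /lebesgue_outer.
  set S := (X in ereal_inf X); move infS : (ereal_inf S) => iS.
  case: iS infS => [r Sr|Soo|Soo].
  - have en1 : (0 < e%:num / (2 ^ n.+1)%:R)%R by [].
    have /(lb_ereal_inf_adherent en1) : ereal_inf S \is a fin_num by rewrite Sr.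
    by move=> [x [I AI <-] xS]; exists I; split => //; rewrite -Sr; exact/ltW.
  - by have := Aoo n; rewrite /lebesgue_outer Soo.
  - by have := lebesgue_outer_ge0 (A n); rewrite /lebesgue_outer Soo.
pose v (x : nat * nat) : \bar R := (box_volume (uncurry G x))%:E.
have v_ge0 x : 0 <= v x by exact: box_volume_ge0.
apply: (@le_trans _ _ (\esum_(i in setT) v i)).
  apply: ereal_inf_lbound => /=.
  have /card_esym/ppcard_eqP[f] := card_nat2.
  exists (uncurry G \o f).
    move=> t [i _] /(PG i).1 [j _ Bijt]; exists (f^-1%FUN (i, j)) => //=.
    by rewrite invK ?inE.
  rewrite -(esum_pred_image v _ xpredT) ?[fun=> _]set_true//.
  by rewrite image_eq.
rewrite (_ : esum _ _ = \sum_(i <oo) \sum_(j <oo) v (i, j)); last first.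
  pose J : nat -> set (nat * nat) := fun i => [set (i, j) | j in setT].
  rewrite (_ : setT = \bigcup_k J k); last first.
    by rewrite predeqE => -[a b]; split => // _; exists a => //; exists b.
  rewrite esum_bigcupT /=; last 2 first.
    - apply/trivIsetP => i j _ _ ij.
      rewrite predeqE => -[n m] /=; split => //= -[] [_] _ [<-{n} _].
      by move=> [m' _] [] /esym/eqP; rewrite (negbTE ij).
    - by move=> x; exact: v_ge0.
  rewrite -(image_id [set: nat]) -fun_true esum_pred_image//; last first.
    by move=> n _; exact: esum_ge0.
  apply: eq_eseriesr => /= j _.
  rewrite -(esum_pred_image v (pair j) predT)//=; last first.
    by move=> ? ? _ _; exact: (@can_inj _ _ _ snd).
  by congr esum; rewrite predeqE => -[a b]; split; move=> [i _ <-]; exists i.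
apply: lee_nneseries => [i _ _|i _]; last exact: (PG i).2.
by apply: nneseries_ge0 => *; exact: v_ge0.
Qed.

HB.instance Definition _ := isOuterMeasure.Build R 'rV[R]_d lebesgue_outer
  lebesgue_outer0 lebesgue_outer_ge0 le_lebesgue_outer
  lebesgue_outer_sigma_subadditive.

End lebesgue_outer.
Arguments lebesgue_outer : clear implicits.

(* R^d with its Lebesgue sigma-algebra: the sets that are Caratheodory
   measurable for the Lebesgue outer measure. *)
Notation lebesgue_rV R d := (caratheodory_type (lebesgue_outer R d)).

Definition convex_hull (R : realType) (E : lmodType R) (S : set E) : set E :=
  [set x | exists (n : nat) (w : 'I_n -> R) (v : 'I_n -> E),
    [/\ forall i, 0 <= w i, \sum_i w i = 1, forall i, S (v i)
      & x = \sum_i w i *: v i]].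

Definition extreme_point (R : realType) (E : lmodType R) (S : set E) (s : E) :=
  S s /\ ~ convex_hull (S `\ s) s.

Section estimators.
Context (R : realType) (d : nat) (disp : measure_display)
  (X : measurableType disp).

Definition estimator_in (Theta' : set 'rV[R]_d) (g : X -> 'rV[R]_d) :=
  measurable_fun [set: X] (g : X -> lebesgue_rV R d) /\
  (forall x, Theta' (g x)).

(* The expectation of an R^d-valued map exists iff every coordinate is
   integrable, and is then computed coordinatewise. *)
Definition has_expectation (P : probability X R) (g : X -> 'rV[R]_d)
    (m : 'rV[R]_d) :=
  forall i, P.-integrable [set: X] (fun x => (g x ord0 i)%:E) /\
            'E_P[fun x => g x ord0 i]%E = (m ord0 i)%:E.

Definition unbiased (Theta' : set 'rV[R]_d) (P : Theta' -> probability X R)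
    (g : X -> 'rV[R]_d) :=
  forall theta : Theta', has_expectation (P theta) g (\val theta).

End estimators.

(* Main.v *)
(* Where an estimator g avoids theta_e, its values lie in Theta' \ {theta_e}.
   If that event has positive P_theta_e-probability, then unbiasedness makes
   theta_e the barycenter of g on it, and barycenters belong to the convex hull
   (not only to its closure), against extremality.  Otherwise g = theta_e almost
   surely under P_theta_e, hence under P_theta', so that theta' = theta_e.

   The integral of a map with values in a convex cone K of R^n lies in K.  This
   goes by induction on n, without separating hyperplanes: when h = (y, h') has
   integral 0, each y(x1) h'(x2) - y(x2) h'(x1) with y(x1) > 0 > y(x2) is in the
   slice K' = {v | (0, v) in K}.  Integrating first in x1, then in x2, and adding
   the part where y = 0 gives (\int_{y>0} y) (\int h') = 0 in K'. *)
Require Import Defs.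
From mathcomp Require Import all_boot all_order all_algebra.
From mathcomp Require Import all_classical all_reals all_analysis.
From mathcomp Require Import measurable_realfun.
Import Order.TTheory GRing.Theory Num.Theory.
Local Open Scope classical_set_scope.
Local Open Scope ring_scope.

(** The scalars are strictly positive, so the origin may lie outside a cone. Hence a conclusion
    [K 0] has content. *)
Definition convex_cone {R : realType} {E : lmodType R} (K : set E) :=
  (forall u v, K u -> K v -> K (u + v)) /\
  (forall (t : R) u, 0 < t -> K u -> K (t *: u)).

(** * Vector-valued integrals and convex cones *)

Section vector_integral.
Context {R : realType} {disp : measure_display} {X : measurableType disp}.
Variable mu : {finite_measure set X -> \bar R}.

Definition rV_integrable {n} (D : set X) (h : X -> 'rV[R]_n) :=
  forall i, mu.-integrable D (fun x => (h x ord0 i)%:E).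

Definition rV_integral {n} (D : set X) (h : X -> 'rV[R]_n) : 'rV[R]_n :=
  \row_i \int[mu]_(x in D) h x ord0 i.

Lemma integrable_lin (D : set X) (f g : X -> R) (a b : R) :
  measurable D -> mu.-integrable D (EFin \o f) -> mu.-integrable D (EFin \o g) ->
  mu.-integrable D (EFin \o (fun x => a * f x + b * g x)).
Proof.
move=> mD fi gi.
apply: (eq_integrable mD (fun x => a%:E * (f x)%:E + b%:E * (g x)%:E)%E) => //.
by apply: integrableD => //; exact: integrableZl.
Qed.

Lemma Rintegral_lin (D : set X) (f g : X -> R) (a b : R) :
  measurable D -> mu.-integrable D (EFin \o f) -> mu.-integrable D (EFin \o g) ->
  \int[mu]_(x in D) (a * f x + b * g x) =
  a * (\int[mu]_(x in D) f x) + b * (\int[mu]_(x in D) g x).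
Proof.
move=> mD fi gi; rewrite RintegralD ?RintegralZl//.
- by apply: (eq_integrable mD (fun x => a%:E * (f x)%:E)%E) => //; exact: integrableZl.
- by apply: (eq_integrable mD (fun x => b%:E * (g x)%:E)%E) => //; exact: integrableZl.
Qed.

Lemma Rintegral_null (D : set X) (f : X -> R) :
  measurable D -> mu.-integrable D (EFin \o f) -> mu D = 0%E ->
  \int[mu]_(x in D) f x = 0.
Proof.
move=> mD /integrableP[mf _] D0.
by rewrite /Rintegral (null_set_integral mD mf D0).
Qed.

(** A vanishing integral would be that of the absolute value, forcing [f] to be zero almost
    everywhere on [D] and [D] to be null. *)
Lemma Rintegral_gt0 (D : set X) (f : X -> R) :
  measurable D -> mu.-integrable D (EFin \o f) -> (forall x, D x -> 0 < f x) ->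
  mu D != 0%E -> 0 < \int[mu]_(x in D) f x.
Proof.
move=> mD fi f0 D0; rewrite lt_neqAle Rintegral_ge0 ?andbT; last first.
  by move=> x /f0/ltW.
apply: contra_neq D0 => /esym If0.
have [mf _] := integrableP _ _ _ fi.
have : (\int[mu]_(x in D) `|(f x)%:E| = 0)%E.
  rewrite (eq_integral (EFin \o f)); last first.
    by move=> x /set_mem/f0/ltW fx; rewrite /= ger0_norm.
  by rewrite -(fineK (integrable_fin_num mD fi)); congr EFin.
move/(ae_eq_integral_abs mu mD mf) => [N [mN N0 DN]].
apply: (subset_measure0 mD mN _ N0) => x Dx; apply: DN => /= /(_ Dx)[].
by apply/eqP; rewrite gt_eqF// f0.
Qed.

Lemma rV_integrableS {n} (D E : set X) (h : X -> 'rV[R]_n) :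
  measurable D -> measurable E -> E `<=` D ->
  rV_integrable D h -> rV_integrable E h.
Proof. by move=> mD mE ED hi i; apply: integrableS (hi i). Qed.

(** The shape [a *: h x + y x *: v] serves two purposes: translation by a constant vector, with [y]
    constant, and combinations of values at two points, one of them fixed. *)
Lemma rV_integrable_lin {n} (D : set X) (h : X -> 'rV[R]_n) (y : X -> R)
    (a : R) (v : 'rV[R]_n) : measurable D ->
  rV_integrable D h -> mu.-integrable D (EFin \o y) ->
  rV_integrable D (fun x => a *: h x + y x *: v).
Proof.
move=> mD hi yi i.
apply: (eq_integrable mD
  (EFin \o (fun x => a * h x ord0 i + v ord0 i * y x))) => [x _|].
  by rewrite /= !mxE [v _ _ * _]mulrC.
by apply: integrable_lin => //; exact: hi.
Qed.

Lemma rV_integral_lin {n} (D : set X) (h : X -> 'rV[R]_n) (y : X -> R)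
    (a : R) (v : 'rV[R]_n) : measurable D ->
  rV_integrable D h -> mu.-integrable D (EFin \o y) ->
  rV_integral D (fun x => a *: h x + y x *: v) =
  a *: rV_integral D h + (\int[mu]_(x in D) y x) *: v.
Proof.
move=> mD hi yi; apply/rowP => i; rewrite !mxE [X in _ = _ + X]mulrC.
rewrite -Rintegral_lin//; last exact: hi.
by apply: eq_Rintegral => x _; rewrite !mxE [v _ _ * _]mulrC.
Qed.

Lemma rV_integral_null {n} (D : set X) (h : X -> 'rV[R]_n) : measurable D ->
  rV_integrable D h -> mu D = 0%E -> rV_integral D h = 0.
Proof.
move=> mD hi D0; apply/rowP => i; rewrite !mxE.
by apply: Rintegral_null => //; exact: hi.
Qed.

Lemma rV_integral_setU {n} (D E : set X) (h : X -> 'rV[R]_n) :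
  measurable D -> measurable E -> D `&` E = set0 -> rV_integrable (D `|` E) h ->
  rV_integral (D `|` E) h = rV_integral D h + rV_integral E h.
Proof.
move=> mD mE DE hi; apply/rowP => i; rewrite !mxE Rintegral_setU//.
  exact: hi.
by apply/disj_setPS; rewrite DE.
Qed.

(* Applied to [K - t m] with [t > 0] and [m] the integral, a statement about
   zero integrals yields one about arbitrary integrals.  [Z] is the statement
   [zero_in_cone] in dimension [n], available there by induction. *)
Lemma integral_in_cone_of_zero {n}
  (Z : forall (K : set 'rV[R]_n) (D : set X) (h : X -> 'rV[R]_n),
    convex_cone K -> measurable D -> mu D != 0%E -> rV_integrable D h ->
    (forall x, D x -> K (h x)) -> rV_integral D h = 0 -> K 0)
  (K : set 'rV[R]_n) (D : set X) (h : X -> 'rV[R]_n) :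
  convex_cone K -> measurable D -> mu D != 0%E -> rV_integrable D h ->
  (forall x, D x -> K (h x)) -> K (rV_integral D h).
Proof.
move=> [KD KZ] mD D0 hi hK; set m := rV_integral D h.
pose K1 : set 'rV[R]_n :=
  [set w | exists u t, [/\ K u, 0 < t & w = u - t *: m]].
have Dfin : mu D \is a fin_num by exact: fin_num_measure.
have muD0 : 0 < fine (mu D).
  by rewrite fine_gt0// lt0e D0 measure_ge0/= ltey_eq Dfin.
(* The constant [c] has integral 1 over [D], so [h - c m] has integral zero; as [c] is positive, its
   values lie in [K1]. *)
set c := (fine (mu D))^-1.
have c0 : 0 < c by rewrite invr_gt0.
have ci : mu.-integrable D (EFin \o (fun=> c)).
  exact: finite_measure_integrable_cst.
have [||||u [t [Ku t0]]] := Z K1 D (fun x => 1 *: h x + c *: - m) _ mD D0.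
- split.
    move=> _ _ [u [s [Ku s0 ->]]] [v [t [Kv t0 ->]]].
    exists (u + v), (s + t); split; [exact: KD|exact: addr_gt0|].
    by rewrite scalerDl opprD addrACA.
  move=> r _ r0 [u [s [Ku s0 ->]]].
  exists (r *: u), (r * s); split; [exact: KZ|exact: mulr_gt0|].
  by rewrite scalerBr scalerA.
- exact: rV_integrable_lin.
- by move=> x Dx; exists (h x), c; split; [exact: hK| |rewrite scale1r scalerN].
- rewrite rV_integral_lin// Rintegral_cst// mulVf ?gt_eqF//.
  by rewrite !scale1r subrr.
- move/esym/eqP; rewrite subr_eq0 => /eqP um.
  have -> : m = t^-1 *: u by rewrite um scalerA mulVf ?scale1r ?gt_eqF.
  by apply: KZ => //; rewrite invr_gt0.
Qed.

Lemma zero_in_cone n (K : set 'rV[R]_n) (D : set X) (h : X -> 'rV[R]_n) :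
  convex_cone K -> measurable D -> mu D != 0%E -> rV_integrable D h ->
  (forall x, D x -> K (h x)) -> rV_integral D h = 0 -> K 0.
Proof.
elim: n K D h => [|n IH]; last rewrite -[n.+1]add1n; move=> K D h Kc mD D0 hi hK h0.
  (* In dimension 0 every vector is 0, so one value of [h] on the nonempty [D] suffices. *)
  have /set0P[x Dx] : D != set0.
    by apply: contra_neq D0 => ->; rewrite measure0.
  by have := hK x Dx; rewrite [h x]thinmx0.
have [KD KZ] := Kc.
pose y x : R := h x ord0 (lshift n ord0).
pose h' x : 'rV[R]_n := rsubmx (h x).
pose K' : set 'rV[R]_n := [set v | K (row_mx 0 v)].
have hE x : h x = row_mx (y x)%:M (h' x).
  rewrite -[LHS]hsubmxK [in LHS](mx11_scalar (lsubmx _)).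
  by rewrite mxE.
have K'c : convex_cone K'.
  split=> [u v Ku Kv|t u t0 Ku]; rewrite /K'/=.
    by rewrite -[0]addr0 -add_row_mx; exact: KD.
  by rewrite -[0](scaler0 _ t) -scale_row_mx; exact: KZ.
have [K'D K'Z] := K'c.
have yi : mu.-integrable D (EFin \o y) by exact: hi.
have h'i : rV_integrable D h'.
  by move=> i; apply: eq_integrable (hi (rshift 1 i)) => // x _; rewrite mxE.
have Iy : \int[mu]_(x in D) y x = 0 by move/rowP: h0 => /(_ (lshift n ord0)); rewrite !mxE.
have Ih' : rV_integral D h' = 0.
  apply/rowP => i; move/rowP: h0 => /(_ (rshift 1 i)); rewrite !mxE => <-.
  by apply: eq_Rintegral => x _; rewrite mxE.
suff : K' 0 by rewrite /K'/= row_mx0.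
have my : measurable_fun D y.
  by have /integrableP[/measurable_EFinP] := yi.
pose Dp := D `&` [set x | 0 < y x]; pose Dn := D `&` [set x | y x < 0].
pose Dz := D `&` [set x | y x = 0].
have mDp : measurable Dp.
  apply: (@emeasurable_fun_o_infty _ _ _ D (EFin \o y) mD _ 0%E).
  exact/measurable_EFinP.
have mDn : measurable Dn.
  apply: (@emeasurable_fun_infty_o _ _ _ D (EFin \o y) mD _ 0%E).
  exact/measurable_EFinP.
have mDz : measurable Dz.
  rewrite (_ : Dz = D `\` (Dp `|` Dn)).
    by apply: measurableD => //; exact: measurableU.
  apply/seteqP; split=> x; rewrite /Dz /Dp /Dn /=.
    by move=> [Dx yx]; split=> //; rewrite yx ltxx => -[] [].
  move=> [Dx yx]; split=> //; apply/eqP; rewrite eq_le !leNgt.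
  by apply/andP; split; apply/negP => ?; apply: yx; [left|right].
have DE : D = (Dp `|` Dn) `|` Dz.
  apply/seteqP; split=> [x Dx|x [[]|] []//]; rewrite /Dz /Dp /Dn /=.
  by case: (ltgtP (y x) 0) => yx; [left; right|left; left|right].
have Dpn0 : Dp `&` Dn = set0.
  by apply/seteqP; split=> // x [[_ /= yx] [_ /=]]; rewrite ltNge (ltW yx).
have Dpnz0 : (Dp `|` Dn) `&` Dz = set0.
  by apply/seteqP; split=> // x [[|] [_ /= yx] [_ /= y0]]; move: yx; rewrite y0 ltxx.
have mDpn : measurable (Dp `|` Dn) by exact: measurableU.
have sub A : measurable A -> A `<=` D ->
    mu.-integrable A (EFin \o y) /\ rV_integrable A h'.
  by move=> mA AD; split; [exact: integrableS yi|exact: rV_integrableS h'i].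
have [ypi hpi] := sub Dp mDp (@subIsetl _ _ _).
have [yni hni] := sub Dn mDn (@subIsetl _ _ _).
have [yzi hzi] := sub Dz mDz (@subIsetl _ _ _).
have [ypni hpni] : mu.-integrable (Dp `|` Dn) (EFin \o y) /\
    rV_integrable (Dp `|` Dn) h'.
  by apply: sub => // x [] [].
(* The induction hypothesis, now for integrals of any value; it will be applied to the slice
   [K']. *)
have B := integral_in_cone_of_zero IH.
move: Iy; rewrite DE Rintegral_setU ?Rintegral_setU -?DE//; last 2 first.
- by apply/disj_setPS; rewrite Dpn0.
- by apply/disj_setPS; rewrite Dpnz0.
rewrite [X in _ + X](@eq_Rintegral _ _ _ mu Dz (fun=> 0) y); last first.
  by move=> x /set_mem[].
rewrite Rintegral_cst// mul0r addr0.
(* Since [y] has total integral zero and vanishes on [Dz], [Y] is also the integral of [- y] over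
   [Dn]. *)
set Y := \int[mu]_(x in Dp) _ => Yn.
move: Ih'; rewrite DE !rV_integral_setU -?DE// => Ih'.
have IN : \int[mu]_(x in Dn) (- y x) = Y.
  under eq_Rintegral do rewrite -mulN1r.
  by rewrite RintegralZl// mulN1r; apply/eqP; rewrite eqr_oppLR -addr_eq0 addrC Yn.
have yNi : mu.-integrable Dn (EFin \o (fun x => - y x)).
  apply: (eq_integrable mDn (fun x => (-1)%:E * (y x)%:E)%E) => [x _|].
    by rewrite /= -EFinM mulN1r.
  exact: integrableZl.
(* If [Dp] is null, so is [Dn], because [- y] is positive there with integral [Y = 0]. All the mass
   is then on [Dz], where [h'] takes its values in [K']. *)
have [Dp0|Dp0] := eqVneq (mu Dp) 0%E.
  have Y0 : Y = 0 by exact: Rintegral_null.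
  have Dn0 : mu Dn = 0%E.
    apply/eqP; apply: contraT => /(Rintegral_gt0 _ _ mDn yNi).
    by rewrite IN Y0 ltxx => -> // x [_ /=]; rewrite oppr_gt0.
  have Dz0 : mu Dz != 0%E.
    by apply: contra_neq D0 => Dz0; rewrite DE !measureU0.
  rewrite -Ih' (rV_integral_null Dp)// (rV_integral_null Dn)// !add0r.
  by apply: B => // x [Dx yx]; rewrite /K'/=; have := hK x Dx; rewrite hE yx raddf0.
have Y0 : 0 < Y by apply: Rintegral_gt0 => // x [].
have Dn0 : mu Dn != 0%E.
  apply: contraTneq Y0 => Dn0.
  by rewrite -IN Rintegral_null ?ltxx.
set v := rV_integral Dp h' in Ih'.
(* The positive weights [- y x2] on [h x1] and [y x1] on [h x2] cancel the first coordinate;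
   integrating over [x1] in [Dp] turns [y x1] into [Y] and [h' x1] into [v]. *)
have Kw x2 : Dn x2 -> K' (Y *: h' x2 + (- y x2) *: v).
  move=> [Dx2 /= y2]; rewrite addrC -rV_integral_lin//.
  apply: B => //; first exact: rV_integrable_lin.
  move=> x1 [Dx1 /= y1].
  have : K (- y x2 *: h x1 + y x1 *: h x2).
    by apply: KD; apply: KZ; rewrite ?oppr_gt0//; exact: hK.
  rewrite (hE x1) (hE x2) !scale_row_mx add_row_mx !scale_scalar_mx -raddfD/=.
  by rewrite mulNr mulrC addNr raddf0.
have := B K' Dn _ K'c mDn Dn0 (rV_integrable_lin _ _ _ Y v mDn hni yNi) Kw.
rewrite rV_integral_lin// IN -scalerDr addrC => Kpn.
(* [Kpn] puts [Y] times the integral of [h'] over [Dp] and [Dn] in [K']. A null [Dz] is treated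
   apart: its contribution is 0, not yet known to lie in [K']. *)
have [Dz0|Dz0] := eqVneq (mu Dz) 0%E.
  move: Ih' Kpn; rewrite (rV_integral_null _ _ mDz hzi Dz0) addr0 => ->.
  by rewrite scaler0.
rewrite -(scaler0 _ Y) -Ih' scalerDr; apply: K'D => //; apply: K'Z => //.
by apply: B => // x [Dx yx]; rewrite /K'/=; have := hK x Dx; rewrite hE yx raddf0.
Qed.

End vector_integral.

(** * Positive hulls and their link to convex hulls *)

(** Requiring a positive total weight excludes the trivial combination, so that 0 belongs only when
    a nontrivial one vanishes. *)
Definition positive_hull {R : realType} {E : lmodType R} (S : set E) : set E :=
  [set x | exists (n : nat) (w : 'I_n -> R) (v : 'I_n -> E),
    [/\ forall i, 0 <= w i, 0 < \sum_i w i, forall i, S (v i)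
      & x = \sum_i w i *: v i]].

Lemma positive_hull_cone {R : realType} {E : lmodType R} (S : set E) :
  convex_cone (positive_hull S).
Proof.
split=> [_ _ [p [w [u [w0 sw Su ->]]]] [q [z [v [z0 sz Sv ->]]]]|].
  (* Concatenation of two finite families, used for both the weights and the points. *)
  pose c T (f : 'I_p -> T) (g : 'I_q -> T) (i : 'I_(p + q)) :=
    match fintype.split i with inl j => f j | inr k => g k end.
  have cl T f g j : c T f g (lshift q j) = f j.
    by rewrite /c -[lshift q j]/(unsplit (inl j)) unsplitK.
  have cr T f g k : c T f g (rshift p k) = g k.
    by rewrite /c -[rshift p k]/(unsplit (inr k)) unsplitK.
  exists (p + q)%N, (c _ w z), (c _ u v); split.
  - by move=> i; rewrite /c; case: (fintype.split i).
  - rewrite big_split_ord/=; under eq_bigr do rewrite cl.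
    by under [X in _ + X]eq_bigr do rewrite cr; exact: addr_gt0.
  - by move=> i; rewrite /c; case: (fintype.split i).
  - rewrite big_split_ord/=; congr (_ + _); apply: eq_bigr => i _.
      by rewrite !cl.
    by rewrite !cr.
move=> t _ t0 [p [w [u [w0 sw Su ->]]]].
exists p, (fun i => t * w i), u; split=> //.
- by move=> i; rewrite mulr_ge0// ltW.
- by rewrite -mulr_sumr mulr_gt0.
- by rewrite scaler_sumr; apply: eq_bigr => i _; rewrite scalerA.
Qed.

(** Dividing the weights by their sum and translating the points by [m] turns a vanishing
    combination into a convex one equal to [m]. *)
Lemma convex_hull_positive_hull {R : realType} {E : lmodType R} (S : set E)
    (m : E) : positive_hull [set v | S (v + m)] 0 -> convex_hull S m.
Proof.
move=> [p [w [v [w0 sw Sv v0]]]]; set s := \sum_i w i in sw.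
exists p, (fun i => s^-1 * w i), (fun i => v i + m); split=> //.
- by move=> i; rewrite mulr_ge0// invr_ge0 ltW.
- by rewrite -mulr_sumr mulVf// gt_eqF.
- under eq_bigr do rewrite scalerDr -!scalerA.
  rewrite big_split/= -!scaler_sumr -v0 scaler0 add0r -scaler_suml scalerA.
  by rewrite mulVf ?scale1r// gt_eqF.
Qed.

(** * Nonexistence of the unbiased estimator *)

Theorem lemma1 (R : realType) (d : nat) (Theta Theta' : set 'rV[R]_d)
    (Theta'_sub : Theta' `<=` Theta)
    (Theta'_not_singleton : ~ exists t : 'rV[R]_d, Theta' = [set t])
    (disp : measure_display) (X : measurableType disp)
    (P : Theta' -> probability X R)
    (theta_e theta' : Theta')
    (theta_e_extreme : extreme_point Theta' (\val theta_e))
    (theta'_neq : theta' <> theta_e)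
    (P_abs_cont : P theta' `<< P theta_e /\ P theta_e `<< P theta') :
  ~ exists g : X -> 'rV[R]_d, estimator_in Theta' g /\ unbiased P g.
Proof.
move=> [g [[_ gT] gU]]; set m := \val theta_e in theta_e_extreme.
pose f x := 1 *: g x + 1 *: - m.
pose D := [set x | g x != m].
(* [D] is a finite union over the coordinates, each of which is measurable as part of its
   integrability. *)
have mD : measurable D.
  have -> : D = \bigcup_(i in [set: 'I_d])
      (setT `&` [set x | (g x ord0 i)%:E != (m ord0 i)%:E]).
    apply/seteqP; split=> [x /eqP gm|x [i _ [_ /=]]].
      have /existsNP[i gmi] : ~ forall i, g x ord0 i = m ord0 i.
        by move=> gm'; apply: gm; apply/rowP.
      by exists i => //; split=> //=; rewrite eqe; exact/eqP.
    by rewrite eqe => /eqP gm; apply/eqP => gxm; apply: gm; rewrite gxm.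
  apply: fin_bigcup_measurable => // i _; apply: emeasurable_neq => //.
  by have [/integrableP[]] := gU theta_e i.
have gi t : rV_integrable (P t) setT g by move=> i; have [] := gU t i.
have ci t : (P t).-integrable setT (EFin \o (fun=> 1 : R)).
  exact: finite_measure_integrable_cst.
have fi t : rV_integrable (P t) setT f.
  exact: (rV_integrable_lin _ setT g (fun=> 1) 1 (- m) measurableT (gi t) (ci t)).
have mean t : rV_integral (P t) setT f = \val t - m.
  rewrite (rV_integral_lin _ setT g (fun=> 1) 1 (- m) measurableT (gi t) (ci t)).
  have P1 : fine (P t setT) = 1 by rewrite probability_setT.
  rewrite scale1r Rintegral_cst// [fine _]P1 mul1r scale1r.
  congr (_ - _); apply/rowP => i; rewrite mxE.
  by have [_] := gU t i; rewrite /Rintegral unlock => ->.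
(* Off [D] the map [f = g - m] is zero, so restricting to [D] keeps its integral. *)
have int_D t : rV_integral (P t) D f = \val t - m.
  have mC : measurable (~` D) by exact: measurableC.
  rewrite -mean -[in RHS](setUv D) rV_integral_setU ?setUv ?setICr//.
  rewrite -[LHS]addr0; congr (_ + _); apply/rowP => i; rewrite !mxE.
  rewrite (@eq_Rintegral _ _ _ (P t) _ (fun=> 0)); last first.
    move=> x /set_mem /= /negP; rewrite negbK => /eqP gm.
    by rewrite /f gm !scale1r subrr mxE.
  by rewrite Rintegral_cst// mul0r.
have fDi t : rV_integrable (P t) D f by exact: rV_integrableS (fi t).
have [PD0|PD0] := eqVneq (P theta_e D) 0%E.
  have P'D0 : P theta' D = 0%E.
    have [+ _] := P_abs_cont; move=> /(_ D).
    by rewrite !measure0_null_setP//; exact.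
  apply: theta'_neq; apply/val_inj/eqP; rewrite -subr_eq0 -int_D.
  by rewrite rV_integral_null.
case: theta_e_extreme => _; apply; apply: convex_hull_positive_hull.
apply: (zero_in_cone (P theta_e) _ _ D f _ mD PD0 (fDi _)).
- exact: positive_hull_cone.
(* Each value [f x] is a one-term combination, since [f x + m = g x] lies in [Theta'] and differs
   from [m] on [D]. *)
- move=> x Dx; exists 1%N, (fun=> 1), (fun=> f x); split=> //.
  + by rewrite big_ord1.
  + move=> _; rewrite /f/= !scale1r subrK; split; [exact: gT|exact/eqP].
  + by rewrite big_ord1 scale1r.
- by rewrite int_D subrr.
Qed.
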